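(* Let $E$ be an infinite dimensional Banach space and $p,q\in[1,\infty]$. If $\mathrm{FBL}^{(p)}[E]$ is $q$-convex, then $q\le\max\{2,p\}$.
   Context: Banach spaces are real. $H[E]$ is the vector lattice (pointwise operations) of positively homogeneous functions $f:E^*\to\mathbb R$. For $1\le p<\infty$ put $\|f\|_{\mathrm{FBL}^{(p)}[E]}=\sup\{(\sum_{k=1}^n|f(x_k^* )|^p)^{1/p}: n\in\mathbb N,\ x_1^*,\dots,x_n^*\in E^*,\ \sup_{x\in B_E}\sum_{k=1}^n|x_k^*(x)|^p\le 1\}$, and for $p=\infty$ put $\|f\|_{\mathrm{FBL}^{(\infty)}[E]}=\sup_{x^*\in B_{E^*}}|f(x^* )|$. For $x\in E$ let $\delta_x(x^* )=x^*(x)$. $\mathrm{FBL}^{(p)}[E]$ is the closure, in the space of $f\in H[E]$ with finite norm, of the sublattice generated by $\{\delta_x:x\in E\}$. A Banach lattice $X$ is $q$-convex if there is $M$ with $\|(\sum_{k=1}^n|x_k|^q)^{1/q}\|\le M(\sum_{k=1}^n\|x_k\|^q)^{1/q}$ for all $x_1,\dots,x_n\in X$ (for $q=\infty$: $\|\bigvee_k|x_k|\|\le M\max_k\|x_k\|$). *)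

(* Defs.v *)
From HB Require Import structures.
From mathcomp Require Import all_boot all_order all_algebra.
From mathcomp Require Import all_classical all_reals all_analysis.

Set Implicit Arguments.
Unset Strict Implicit.
Unset Printing Implicit Defensive.

Import Order.TTheory GRing.Theory Num.Theory.
Import numFieldNormedType.Exports.

Local Open Scope classical_set_scope.
Local Open Scope ring_scope.

Definition infinite_dimensional (R : realType) (E : lmodType R) : Prop :=
  ~ exists (n : nat) (e : 'I_n -> E),
      forall x : E, exists c : 'I_n -> R, x = \sum_(i < n) c i *: e i.

(* The topological dual of E, as a submodule of the module of all functions
   E -> R with pointwise operations. *)
Section Dual.
Variables (R : realType) (E : normedModType R).

Definition dual_pred : {pred E -> R} :=
  fun f => `[< scalar f /\ continuous (f : E -> R^o) >].

Record topdual := Dual { dual_fun :> E -> R; _ : dual_fun \in dual_pred }.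

HB.instance Definition _ := [isSub for dual_fun].
HB.instance Definition _ := [Choice of topdual by <:].

Lemma dual_submod_closed : submod_closed dual_pred.
Proof.
split=> [|a f g /asboolP[linf contf] /asboolP[ling contg]]; apply/asboolP.
- split=> [b x y|x]; first by rewrite /= mulr0 addr0.
  exact: (@cst_continuous E R^o 0 x).
- split=> [b x y|x].
    have addE u : (a *: f + g) u = a * f u + g u by [].
    rewrite !addE linf ling !mulrDr /= !mulrA (mulrC b a) -!addrA.
    by congr (_ + _); rewrite addrCA.
  have cf : {for x, continuous (fun u => a *: (f u : R^o))}.
    by apply: continuousZl_tmp; exact: contf.
  exact: (continuousD cf (contg x)).
Qed.

HB.instance Definition _ :=
  GRing.isSubmodClosed.Build R (E -> R) dual_pred dual_submod_closed.
HB.instance Definition _ := [SubChoice_isSubLmodule of topdual by <:].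

Definition dual_norm (phi : topdual) : \bar R :=
  ereal_sup [set `|phi x|%:E | x in [set x : E | `|x| <= 1]].

Lemma eval_dual_pred (phi : topdual) : scalar phi /\ continuous (phi : E -> R^o).
Proof. by case: phi => f /= /asboolP. Qed.

End Dual.

Section FreeBanachLattice.
Variables (R : realType) (E : normedModType R).

Definition pos_homogeneous : set (topdual E -> R) :=
  [set f | forall (a : R) (phi : topdual E), 0 <= a -> f (a *: phi) = a * f phi].

Definition vector_sublattice (S : set (topdual E -> R)) : Prop :=
  [/\ S `<=` pos_homogeneous,
      S 0,
      (forall (a : R) f g, S f -> S g -> S (a *: f + g)),
      (forall f g, S f -> S g -> S (fun phi => Num.max (f phi) (g phi))) &
      (forall f g, S f -> S g -> S (fun phi => Num.min (f phi) (g phi)))].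

Definition delta (x : E) : topdual E -> R := fun phi => phi x.

Definition weak_lp_ball (p : R) (n : nat) (phi : 'I_n -> topdual E)
    : Prop :=
  (ereal_sup [set (\sum_(k < n) `|phi k x| `^ p)%:E
               | x in [set x : E | (`|x| <= 1)%R]] <= 1)%E.

Definition fbl_norm (p : \bar R) (f : topdual E -> R) : \bar R :=
  match p with
  | r%:E => ereal_sup
      [set y | exists (n : nat) (phi : 'I_n -> topdual E),
        weak_lp_ball r phi /\
        y = ((\sum_(k < n) `|f (phi k)| `^ r) `^ r^-1)%:E]
  | +oo%E => ereal_sup
      [set `|f phi|%:E | phi in [set phi | (dual_norm phi <= 1)%E]]
  | -oo%E => 0%E
  end.

Definition fbl_finite (p : \bar R) : set (topdual E -> R) :=
  [set f | pos_homogeneous f /\ (fbl_norm p f < +oo)%E].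

Definition FBL (p : \bar R) : set (topdual E -> R) :=
  [set f | fbl_finite p f /\
    forall e : R, 0 < e -> exists2 g,
      smallest vector_sublattice (range delta) g &
      (fbl_norm p (f - g)%R < e%:E)%E].

End FreeBanachLattice.

Arguments FBL {R} E p.

(* (\sum_k |a_k|^q)^(1/q), read as \max_k |a_k| for q = +oo; the value at -oo
   is junk. *)
Definition lq_sum (R : realType) (q : \bar R) (n : nat) (a : 'I_n -> R) : R :=
  match q with
  | r%:E => (\sum_(k < n) `|a k| `^ r) `^ r^-1
  | +oo%E => \big[Num.max/0]_(k < n) `|a k|
  | -oo%E => 0
  end.

(* q-convexity of a Banach lattice X of real functions on T with pointwise
   operations and norm N. Point evaluations are lattice homomorphisms X -> R,
   so the element (\sum_k |f_k|^q)^(1/q) given by the functional calculus of X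
   is the function computed pointwise. *)
Definition q_convex (R : realType) (T : Type) (X : set (T -> R))
    (N : (T -> R) -> \bar R) (q : \bar R) : Prop :=
  exists M : R, forall (n : nat) (f : 'I_n -> T -> R),
    (forall k, X (f k)) ->
    (N (fun t => lq_sum q (fun k => f k t))
       <= (M * lq_sum q (fun k => fine (N (f k))))%:E)%E.

(* Main.v *)
(** By q-convexity it is enough to find, for every n, functionals phi_1, ...,
    phi_n on E with sum_k phi_k(x)^2 <= |x|^2 and points x_k of the unit ball
    with |phi_k(x_k)| >= 1/4. For finite p put m = max(2, p). After scaling by
    n^(1/m - 1/p) / 2 the phi_k are admissible in the FBL^(p) norm, so testing
    q-convexity on the evaluations at x_1, ..., x_n yields
    n^(1/m) / 8 <= |M| n^(1/q) for all n, that is q <= m.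

    Such functionals exist by the Dvoretzky-Rogers argument, run directly in
    the dual: fix 2n points y_i of the unit ball and almost maximize
    |det(phi_k(y_i))| over all 2n-tuples with sum_k phi_k(x)^2 <= |x|^2. The
    wanted functionals are coordinates of Phi = (phi_k) along orthonormal
    directions chosen greedily. That the determinant is not identically zero
    is the Hahn-Banach theorem. *)

Require Import Defs.
From HB Require Import structures.
From mathcomp Require Import all_boot all_order all_algebra.
From mathcomp Require Import all_classical all_reals all_analysis.
From mathcomp Require Import perm zify ring lra.
Set Implicit Arguments.
Unset Strict Implicit.
Unset Printing Implicit Defensive.
Import Order.TTheory GRing.Theory Num.Theory.
Import numFieldNormedType.Exports.
Local Open Scope ring_scope.

(** * The Hahn-Banach theorem *)

Section Sublinear.
Variables (R : realType) (V : lmodType R).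
Implicit Types (g h : V -> R) (F : set (V -> R)).
Local Open Scope classical_set_scope.

(** Homogeneity is asked as an inequality, the form that passes to infima; equality is recovered in
    [sublinearZ]. *)
Definition sublinear g : Prop :=
  (forall x y, g (x + y) <= g x + g y) /\
  (forall (a : R) x, 0 <= a -> g (a *: x) <= a * g x).

Lemma sublinearN g x : sublinear g -> - g (- x) <= g x.
Proof.
move=> [gD gZ]; have := gD 0 0; have := gD x (- x).
rewrite subrr addr0; lra.
Qed.

Definition infimum F : V -> R := fun x => inf [set g x | g in F].

(** The real [inf] is meaningful only on sets bounded below, hence the minorant [b]. *)
Lemma infimum_le F (b : V -> R) g x :
  (forall h y, F h -> b y <= h y) -> F g -> infimum F x <= g x.
Proof.
move=> Fb Fg; apply: ge_inf; last by exists g.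
by exists (b x) => _ [h Fh <-]; exact: Fb.
Qed.

Lemma le_infimum F x (c : R) :
  F !=set0 -> (forall h, F h -> c <= h x) -> c <= infimum F x.
Proof.
move=> [g Fg] Fc; apply: lb_le_inf; first by exists (g x), g.
by move=> _ [h Fh <-]; exact: Fc.
Qed.

(** Two members must be merged into one [k], since the infima at [x] and at [y] may be approached
    along different members. *)
Lemma sublinear_infimum F (b : V -> R) :
  F !=set0 -> (forall h x, F h -> b x <= h x) ->
  (forall g h x y, F g -> F h -> exists2 k, F k & k (x + y) <= g x + h y) ->
  (forall g (a : R) x, F g -> 0 <= a ->
    exists2 k, F k & k (a *: x) <= a * g x) ->
  sublinear (infimum F).
Proof.
move=> F0 Fb FD FZ; have Fle := @infimum_le F b _ _ Fb.
split=> [x y|a x].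
  rewrite -lerBlDr; apply: le_infimum => // g Fg.
  rewrite lerBlDr -lerBlDl; apply: le_infimum => // h Fh.
  rewrite lerBlDl; have [k Fk /(le_trans _)] := FD g h x y Fg Fh; apply.
  exact: Fle.
(* The case [a = 0] is separate because the general argument divides by [a]. *)
rewrite le_eqVlt => /orP[/eqP <-|a0].
  have [g Fg] := F0; have [k Fk] := FZ g 0 x Fg (lexx 0).
  by rewrite !mul0r; apply: le_trans; exact: Fle.
rewrite -ler_pdivrMl//; apply: le_infimum => // g Fg.
rewrite ler_pdivrMl//; have [k Fk /(le_trans _)] := FZ g a x Fg (ltW a0).
by apply; exact: Fle.
Qed.

Lemma sublinearZ g (a : R) x : sublinear g -> 0 <= a -> g (a *: x) = a * g x.
Proof.
move=> sg a0; have [gD gZ] := sg; apply/eqP; rewrite eq_le gZ//=.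
have /orP[/eqP <-|{}a0] : (0 == a) || (0 < a) by rewrite -le_eqVlt.
  by rewrite scale0r mul0r; have := gD 0 0; rewrite addr0; lra.
rewrite -ler_pdivlMl// -[X in g X <= _](scalerK (lt0r_neq0 a0)).
by apply: gZ; rewrite invr_ge0 ltW.
Qed.

(* The largest sublinear functional h <= g with h (- y) <= - g y. *)
Definition flatten_along g (y : V) : V -> R :=
  infimum [set (fun x => g (x + t *: y) - t * g y) | t in [set t : R | 0 <= t]].

(** By subadditivity [t * g y = g (t *: y) <= g (x + t *: y) + g (- x)], so the infimum in
    [flatten_along] is taken over a set bounded below. *)
Lemma translate_ge g (y : V) h x : sublinear g ->
  [set (fun x => g (x + t *: y) - t * g y) | t in [set t : R | 0 <= t]] h ->
  - g (- x) <= h x.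
Proof.
move=> sg [t /= t0 <-]; rewrite -(sublinearZ y sg t0).
by have := sg.1 (x + t *: y) (- x); rewrite addrAC subrr add0r; lra.
Qed.

Lemma flatten_along_sublinear g (y : V) :
  sublinear g -> sublinear (flatten_along g y).
Proof.
move=> sg; have [gD gZ] := sg.
apply: (@sublinear_infimum _ (fun x => - g (- x))).
- by exists (fun x => g (x + 0 *: y) - 0 * g y), 0 => /=.
- by move=> h x; exact: translate_ge.
- move=> _ _ x z [s /= s0 <-] [t /= t0 <-].
  exists (fun x => g (x + (s + t) *: y) - (s + t) * g y).
    by exists (s + t) => //=; exact: addr_ge0.
  by have := gD (x + s *: y) (z + t *: y); rewrite addrACA -scalerDl; lra.
- move=> _ a x [t /= t0 <-] a0.
  exists (fun x => g (x + (a * t) *: y) - (a * t) * g y).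
    by exists (a * t) => //=; exact: mulr_ge0.
  by rewrite -scalerA -scalerDr (sublinearZ _ sg)//; lra.
Qed.

Lemma flatten_along_le g (y x : V) : sublinear g -> flatten_along g y x <= g x.
Proof.
move=> sg; have -> : g x = g (x + 0 *: y) - 0 * g y.
  by rewrite scale0r addr0 mul0r subr0.
apply: (@infimum_le _ (fun x => - g (- x)) (fun x => g (x + 0 *: y) - 0 * g y)).
  by move=> h z; exact: translate_ge.
by exists 0 => /=.
Qed.

(** The infimum is tested at [t = 1], where [g (- y + y) = 0]. *)
Lemma flatten_alongN g (y : V) :
  sublinear g -> flatten_along g y (- y) <= - g y.
Proof.
move=> sg; have -> : - g y = g (- y + 1 *: y) - 1 * g y.
  rewrite scale1r addNr mul1r.
  by rewrite -(scale0r (0 : V)) (sublinearZ _ sg)// mul0r sub0r.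
apply: (@infimum_le _ (fun x => - g (- x)) (fun x => g (x + 1 *: y) - 1 * g y)).
  by move=> h z; exact: translate_ge.
by exists 1 => /=.
Qed.

(** Comparison with [flatten_along g x] makes [g] odd, and an odd sublinear functional is linear. *)
Lemma minimal_sublinear_scalar g : sublinear g ->
  (forall h, sublinear h -> (forall x, h x <= g x) -> forall x, g x <= h x) ->
  scalar g.
Proof.
move=> sg gmin; have [gD gZ] := sg.
have gN x : g (- x) = - g x.
  have := gmin _ (flatten_along_sublinear x sg)
            (fun z => flatten_along_le x z sg) (- x).
  have := flatten_alongN x sg; have := sublinearN (- x) sg.
  rewrite opprK => g1 g2 g3.
  by apply/eqP; rewrite eq_le; apply/andP; split; lra.
have gZ' a x : g (a *: x) = a * g x.
  have [a0|a0] := leP 0 a; first exact: sublinearZ.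
  rewrite -[a *: x]opprK -scaleNr gN (sublinearZ _ sg) ?oppr_ge0 ?ltW//.
  by rewrite mulNr opprK.
move=> a x y; rewrite -gZ'; apply/eqP; rewrite eq_le gD /=.
by have := gD (a *: x + y) (- y); rewrite addrK gN; lra.
Qed.

(** Zorn's lemma gives a minimal sublinear functional below [g]; chains are bounded by their
    pointwise infimum. *)
Lemma exists_scalar_le g : sublinear g ->
  exists2 f : V -> R, scalar f & forall x, f x <= g x.
Proof.
move=> sg; pose T := {h : V -> R | sublinear h /\ forall x, h x <= g x}.
(* The order is reversed, so that Zorn's maximal elements are minimal functionals. *)
pose below (h k : T) := `[< forall x, sval k x <= sval h x >].
have [||A Atot|[f [sf fg]] fmin] :=
    @ZL_preorder T (exist _ g (conj sg (fun x => lexx _))) below.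
- by move=> h; apply/asboolP => x.
- move=> h k l /asboolP kh /asboolP lk; apply/asboolP => x.
  exact: le_trans (kh x).
- have [->|/set0P[h0 Ah0]] := eqVneq A set0.
    by exists (exist _ g (conj sg (fun x => lexx _))).
  pose F := [set sval h | h in A].
  have Fb h x : F h -> - g (- x) <= h x.
    move=> [k Ak <-]; case: k {Ak} => k /= [sk kg].
    by have := sublinearN x sk; have := kg (- x); lra.
  have sF : sublinear (infimum F).
    apply: (sublinear_infimum _ Fb); first by exists (sval h0), h0.
      move=> _ _ x y [h Ah <-] [k Ak <-].
      have [/asboolP hk|/asboolP kh] := Atot _ _ Ah Ak.
        exists (sval k); first by exists k.
        by have := (svalP k).1.1 x y; have := hk x; lra.
      exists (sval h); first by exists h.
      by have := (svalP h).1.1 x y; have := kh y; lra.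
    move=> _ a x [h Ah <-] a0; exists (sval h); first by exists h.
    exact: (svalP h).1.2.
  have Fg x : infimum F x <= g x.
    by apply: le_trans (infimum_le x Fb _) ((svalP h0).2 x); exists h0.
  exists (exist _ (infimum F) (conj sF Fg)) => h Ah; apply/asboolP => x /=.
  by apply: (infimum_le x Fb); exists h.
exists f => //; apply: minimal_sublinear_scalar => // h sh hf x.
have hg z : h z <= g z by exact: le_trans (fg z).
have /asboolP := fmin (exist _ h (conj sh hg)) ltac:(by apply/asboolP).
by apply.
Qed.
End Sublinear.

(** * The dual space: separation of points and biorthogonal systems *)

Section DualSpace.
Variables (R : realType) (E : normedModType R).
Implicit Types (phi psi : topdual E) (x y : E).

HB.instance Definition _ phi :=
  GRing.isLinear.Build R E R *%R (dual_fun phi) (eval_dual_pred phi).1.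

Lemma topdualZE (a : R) phi x : (a *: phi) x = a * phi x.
Proof. by []. Qed.

Lemma topdual_sumE n (c : 'I_n -> R) (phi : 'I_n -> topdual E) x :
  (\sum_(i < n) c i *: phi i) x = \sum_(i < n) c i * phi i x.
Proof. by elim/big_rec2 : _ => // i s psi _ <-. Qed.

Lemma topdual_bounded phi :
  exists2 C : R, 0 < C & forall x, `|x| <= 1 -> `|phi x| <= C.
Proof.
have [lphi cphi] := eval_dual_pred phi.
pose f : {linear E -> R^o} := HB.pack (dual_fun phi : E -> R^o)
  (GRing.isLinear.Build R E R^o *:%R (dual_fun phi) lphi).
have /linear_boundedP /pinfty_ex_gt0[C C0 fC] : bounded_near f (nbhs (0 : E)).
  by apply: continuous_linear_bounded; exact: cphi.
exists C => // x x1; apply: le_trans (fC x) _.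
by rewrite -[leRHS]mulr1 ler_wpM2l// ltW.
Qed.

Lemma normed_sublinear : sublinear (fun x : E => `|x|).
Proof.
by split=> [x y|a x a0]; [exact: ler_normD|rewrite normrZ ger0_norm].
Qed.

(** A linear [f] below the norm flattened along [x] has [f (- x) <= - |x| < 0]; lying below the norm
    makes it continuous. *)
Lemma exists_topdual_neq0 x : x != 0 -> exists phi, phi x != 0.
Proof.
move=> x0.
have [f fl fx] := exists_scalar_le (flatten_along_sublinear x normed_sublinear).
have fN y : f (- y) = - f y.
  have f0 : f 0 = 0.
    by rewrite -[in LHS](subrr 0) -scaleN1r addrC fl mulN1r addNr.
  by have := fl (-1) y 0; rewrite scaleN1r mulN1r !addr0 f0 addr0.
have fle y : f y <= `|y|.
  exact: le_trans (fx y) (flatten_along_le x y normed_sublinear).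
have fnorm y : `|f y| <= `|y|.
  by rewrite ler_norml fle andbT lerNl -fN -[leRHS]normrN fle.
have fcont : continuous (f : E -> R^o).
  move=> y; apply/(@cvgrPdist_lt _ _ _ (nbhs y)) => e e0; near=> z.
  have -> : f y - f z = f (y - z).
    by have := fl 1 y (- z); rewrite scale1r mul1r fN.
  apply: le_lt_trans (fnorm _) _.
  by near: z; apply: cvgr_dist_lt.
have fdual : f \in @dual_pred R E by apply/asboolP.
exists (Dual fdual); rewrite /= -oppr_eq0 -fN.
apply: ltr0_neq0; apply: le_lt_trans (fx _) _.
by apply: le_lt_trans (flatten_alongN x normed_sublinear) _;
  rewrite oppr_lt0 normr_gt0.
Unshelve. all: by end_near. Qed.

(** Induction in Gram-Schmidt style: [w] is a vector outside the span of the [y i], corrected so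
    that every [phi i] kills it; [chi] is a functional nonzero at [w], corrected to kill every [y i]
    and normalized at [w]. *)
Lemma exists_biorthogonal n : infinite_dimensional E ->
  exists (y : 'I_n -> E) (phi : 'I_n -> topdual E),
    forall k i, phi k (y i) = (k == i)%:R.
Proof.
move=> Einf; elim: n => [|n [y [phi yphi]]].
  by exists (fun=> 0), (fun=> 0) => - [].
have [z zy] : exists z : E, forall c : 'I_n -> R, z != \sum_(i < n) c i *: y i.
  apply: contra_notP Einf => nz; exists n, y => x.
  apply: contra_notP nz => nc; exists x => c.
  by apply: contra_notN nc => /eqP xc; exists c.
pose w := z - \sum_(i < n) phi i z *: y i.
have phiw k : phi k w = 0.
  rewrite linearB linear_sum (bigD1 k)//= linearZ/= yphi eqxx mulr1.
  rewrite big1 ?addr0 ?subrr//.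
  by move=> i /negPf ik; rewrite linearZ/= yphi eq_sym ik mulr0.
have [psi psiw] : exists psi, psi w != 0.
  by apply: exists_topdual_neq0; rewrite subr_eq0.
have [chi chiE] : exists chi : topdual E, forall x,
    chi x = (psi w)^-1 * (psi x - \sum_(i < n) psi (y i) * phi i x).
  exists ((psi w)^-1 *: (psi - \sum_(i < n) psi (y i) *: phi i)) => x.
  by rewrite -topdual_sumE.
exists (fun i => oapp y w (unlift ord0 i)).
exists (fun i => oapp phi chi (unlift ord0 i)).
move=> k i; case: (unliftP ord0 k) => [k'|] ->;
  case: (unliftP ord0 i) => [i'|] ->;
  rewrite ?liftK ?unlift_none /=.
- by rewrite yphi (inj_eq lift_inj).
- by rewrite phiw.
- rewrite chiE (bigD1 i')//= yphi eqxx mulr1 big1.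
    by rewrite addr0 subrr mulr0.
  by move=> j /negPf ji; rewrite yphi ji mulr0.
- rewrite chiE big1 ?subr0 ?mulVf// => j _.
  by rewrite phiw mulr0.
Qed.

Lemma exists_normalized_biorthogonal n : infinite_dimensional E ->
  exists (y : 'I_n -> E) (phi : 'I_n -> topdual E),
    (forall i, `|y i| <= 1) /\ forall k i, phi k (y i) = (k == i)%:R.
Proof.
move=> /(exists_biorthogonal n)[y [phi yphi]].
have y0 i : `|y i| != 0.
  rewrite normr_eq0; apply: contraTneq (oner_neq0 R) => yi0.
  by rewrite negbK -[1]/(true%:R) -(eqxx i) -yphi yi0 linear0.
exists (fun i => `|y i|^-1 *: y i), (fun k => `|y k| *: phi k); split=> [i|k i].
  by rewrite normrZ normfV normr_id mulVf.
rewrite topdualZE linearZ/= yphi.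
by have [->|_] := eqVneq k i; rewrite ?mulr1 ?mulfV ?mulr0.
Qed.

End DualSpace.

(** * The Dvoretzky-Rogers lemma *)

Section Euclidean.
Variable F : fieldType.

(** Sylvester's identity: the block matrix with rows [1, - X] and [Y, 1] factors into block
    triangular matrices in two ways. *)
Lemma det_1D_mulmxC m n (X : 'M[F]_(m, n)) (Y : 'M[F]_(n, m)) :
  \det (1%:M + X *m Y) = \det (1%:M + Y *m X).
Proof.
have : block_mx (1%:M + X *m Y) (- X) 0 1%:M *m block_mx 1%:M 0 Y 1%:M =
       block_mx 1%:M 0 Y 1%:M *m block_mx 1%:M (- X) 0 (1%:M + Y *m X).
  rewrite !mulmx_block !mulmx1 !mul1mx !mulmx0 !mul0mx !addr0 !add0r.
  by rewrite mulNmx mulmxN addrK addrC addrK.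
move=> /(congr1 determinant); rewrite !det_mulmx !det_ublock !det_lblock.
by rewrite !det1 !mulr1 !mul1r.
Qed.

(** [U^T *m U] is the orthogonal projection onto the row space of [U], so the matrix acts as [a]
    there and as [b] on the complement. *)
Lemma det_scalar_on_rows j n (U : 'M[F]_(j, n)) (a b : F) :
  b != 0 -> U *m U^T = 1%:M ->
  \det (b%:M + (a - b) *: (U^T *m U)) = b ^+ n * (a / b) ^+ j.
Proof.
move=> b0 UU.
have -> : b%:M + (a - b) *: (U^T *m U) =
    b *: (1%:M + (((a - b) / b) *: U^T) *m U).
  by rewrite scalerDr -scalemxAl scalerA mulrC divfK// scalemx1.
rewrite detZ det_1D_mulmxC -scalemxAr UU scalemx1 -raddfD/= det_scalar.
by rewrite mulrBl divff// addrC subrK.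
Qed.

Definition sqnorm n (v : 'cV[F]_n) : F := \sum_i v i 0 ^+ 2.

Lemma sqnormE n (v : 'cV[F]_n) : sqnorm v = (v^T *m v) 0 0.
Proof. by rewrite mxE; apply: eq_bigr => i _; rewrite mxE. Qed.

(** Pythagoras: [U^T] is isometric and [r] is orthogonal to its range. *)
Lemma sqnorm_orthoD j n (U : 'M[F]_(j, n)) (a b : F) w r :
  U *m U^T = 1%:M -> U *m r = 0 ->
  sqnorm (a *: (U^T *m w) + b *: r) = a ^+ 2 * sqnorm w + b ^+ 2 * sqnorm r.
Proof.
move=> UU Ur; rewrite !sqnormE.
have -> : (a *: (U^T *m w) + b *: r)^T = a *: (w^T *m U) + b *: r^T.
  by rewrite linearD/= !linearZ/= trmx_mul trmxK.
have rU : r^T *m U^T = 0 by rewrite -trmx_mul Ur trmx0.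
rewrite mulmxDl !mulmxDr -!scalemxAl -!scalemxAr !mulmxA -(mulmxA w^T U U^T) UU.
rewrite -(mulmxA w^T U r) Ur rU mulmx1 mul0mx mulmx0 !scaler0 addr0 add0r.
by rewrite !scalerA !mxE !expr2.
Qed.

End Euclidean.

(** * Almost maximal determinants and greedy orthonormal directions *)

Section DvoretzkyRogers.
Variables (R : realType) (E : normedModType R).
Implicit Types (x z : E).

Definition eval_col n (phi : 'I_n -> topdual E) x : 'cV[R]_n := \col_k phi k x.

Definition mix m n (Q : 'M[R]_(m, n)) (phi : 'I_n -> topdual E) :
    'I_m -> topdual E :=
  fun k => \sum_l Q k l *: phi l.

Lemma eval_col_mix m n (Q : 'M[R]_(m, n)) phi x :
  eval_col (mix Q phi) x = Q *m eval_col phi x.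
Proof.
apply/colP => k; rewrite !mxE topdual_sumE.
by apply: eq_bigr => l _; rewrite mxE.
Qed.

(** Equivalently, [eval_col phi] has norm at most 1 as an operator from [E] to Euclidean n-space. *)
Definition weak2_ball n (phi : 'I_n -> topdual E) : Prop :=
  forall x, `|x| <= 1 -> sqnorm (eval_col phi x) <= 1.

Lemma sqnorm_ge0 n (v : 'cV[R]_n) : 0 <= sqnorm v.
Proof. by apply: sumr_ge0 => i _; exact: sqr_ge0. Qed.

Lemma weak2_ball_le1 n (phi : 'I_n -> topdual E) x k :
  weak2_ball phi -> `|x| <= 1 -> `|phi k x| <= 1.
Proof.
move=> /(_ x) /[apply] phi1; rewrite -(@expr_le1 _ 2)// real_normK ?num_real//.
apply: le_trans phi1; rewrite /sqnorm (bigD1 k)//= mxE lerDl.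
by apply: sumr_ge0 => i _; exact: sqr_ge0.
Qed.

Definition pairing_mx n (phi : 'I_n -> topdual E) (y : 'I_n -> E) : 'M[R]_n :=
  \matrix_(k, i) phi k (y i).

Lemma pairing_mx_mix n (Q : 'M[R]_n) phi y :
  pairing_mx (mix Q phi) y = Q *m pairing_mx phi y.
Proof.
apply/matrixP => k i; rewrite !mxE topdual_sumE.
by apply: eq_bigr => l _; rewrite mxE.
Qed.

(** The crude Leibniz bound is enough: it only serves to make a supremum finite. *)
Lemma det_pairing_le n (phi : 'I_n -> topdual E) (y : 'I_n -> E) :
  weak2_ball phi -> (forall i, `|y i| <= 1) ->
  `|\det (pairing_mx phi y)| <= #|{perm 'I_n}|%:R.
Proof.
move=> phi1 y1; apply: le_trans (ler_norm_sum _ _ _) _.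
rewrite -sum1_card natr_sum ler_sum// => s _.
rewrite normrM normrX normrN1 expr1n mul1r normr_prod.
apply: prodr_ile1 => i _; rewrite normr_ge0 mxE.
exact: weak2_ball_le1.
Qed.

Lemma exists_weak2_ball_det_neq0 n : infinite_dimensional E ->
  exists (y : 'I_n -> E) (phi : 'I_n -> topdual E),
    [/\ forall i, `|y i| <= 1, weak2_ball phi & \det (pairing_mx phi y) != 0].
Proof.
move=> /(exists_normalized_biorthogonal n)[y [psi [y1 psiy]]].
have /boolp.choice[C HC] : forall k, exists C : R,
    0 < C /\ forall x, `|x| <= 1 -> `|psi k x| <= C.
  by move=> k; have [C C0 ?] := topdual_bounded (psi k); exists C.
(* The sum of the [C k ^+ 2] is [K - 1 <= K ^+ 2], so dividing by [K] lands in the weak 2-ball. *)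
pose K := \sum_k C k ^+ 2 + 1.
have K1 : 1 <= K by rewrite lerDr sumr_ge0// => i _; exact: sqr_ge0.
have K0 : 0 < K by exact: lt_le_trans K1.
exists y, (fun k => K^-1 *: psi k); split=> //.
  move=> x x1; apply: (@le_trans _ _ (\sum_k K^-1 ^+ 2 * C k ^+ 2)).
    apply: ler_sum => k _; rewrite mxE topdualZE exprMn.
    rewrite ler_wpM2l ?sqr_ge0//.
    rewrite -[leLHS]real_normK ?num_real// lerXn2r ?nnegrE//.
      by rewrite ltW// (HC k).1.
    exact: (HC k).2.
  rewrite -mulr_sumr -(addrK 1 (\sum__ _)) -/K exprVn ler_pdivrMl ?exprn_gt0//.
  by rewrite mulr1 expr2; nra.
have -> : pairing_mx (fun k => K^-1 *: psi k) y = K^-1%:M.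
  apply/matrixP => k i; rewrite !mxE.
  by rewrite topdualZE psiy mulr_natr.
by rewrite det_scalar expf_neq0// invr_neq0// gt_eqF.
Qed.

(** Any value above half of the supremum will do, so no compactness is involved. *)
Lemma exists_almost_maximal n : infinite_dimensional E ->
  exists (y : 'I_n -> E) (phi : 'I_n -> topdual E),
    [/\ weak2_ball phi, \det (pairing_mx phi y) != 0 &
      forall psi, weak2_ball psi ->
      `|\det (pairing_mx psi y)| < 2 * `|\det (pairing_mx phi y)|].
Proof.
move=> /(exists_weak2_ball_det_neq0 n)[y [psi [y1 psi1 psi0]]].
pose S : set R :=
  [set `|\det (pairing_mx phi y)| | phi in [set phi | weak2_ball phi]]%classic.
have Sub : has_ubound S.
  by exists #|{perm 'I_n}|%:R => _ [phi phi1 <-]; exact: det_pairing_le.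
have Spsi : S `|\det (pairing_mx psi y)| by exists psi.
have S0 : 0 < sup S.
  by apply: lt_le_trans (ub_le_sup Sub Spsi); rewrite normr_gt0.
have [|_ [phi phi1 <-] Sphi] :=
  @sup_adherent R S (sup S / 2) _ (conj (ex_intro _ _ Spsi) Sub).
  by rewrite divr_gt0.
exists y, phi; split=> // [|chi chi1].
  by rewrite -normr_gt0; lra.
have : S `|\det (pairing_mx chi y)| by exists chi.
by move=> /(ub_le_sup Sub); lra.
Qed.

Lemma dvoretzky_rogers n : infinite_dimensional E ->
  exists (phi : 'I_n -> topdual E) (x : 'I_n -> E),
    [/\ weak2_ball phi, forall k, `|x k| <= 1 &
        forall k, 4^-1 <= `|phi k (x k)|].
Proof.
move=> /(exists_almost_maximal (n + n))[y [phi [phi1 phi0 phimax]]].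
have sq_split j (U : 'M[R]_(j, n + n)) v a b : U *m U^T = 1%:M ->
    sqnorm ((b%:M + (a - b) *: (U^T *m U)) *m v) =
    a ^+ 2 * sqnorm (U *m v) + b ^+ 2 * sqnorm (v - U^T *m (U *m v)).
  move=> UU; rewrite -(sqnorm_orthoD _ _ _ UU); last first.
    by rewrite mulmxBr !mulmxA UU mul1mx subrr.
  congr sqnorm; rewrite mulmxDl mul_scalar_mx -scalemxAl -mulmxA.
  by rewrite scalerBl scalerBr addrCA addrA.
(* Otherwise scaling Phi by 1/2 on the row space of U and by 3 on its orthogonal
   complement stays in the weak 2-ball, as 1/4 + 9/16 <= 1, and at least doubles
   the determinant. *)
have far j (U : 'M[R]_(j, n + n)) : (j < n)%N -> U *m U^T = 1%:M ->
    exists2 z, `|z| <= 1 &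
      4^-1 ^+ 2 <= sqnorm (eval_col phi z - U^T *m (U *m eval_col phi z)).
  move=> jn UU; apply: contrapT => nofar.
  pose Q : 'M[R]_(n + n) := 3%:M + (2^-1 - 3) *: (U^T *m U).
  have /phimax : weak2_ball (mix Q phi).
    move=> x x1; rewrite eval_col_mix sq_split//.
    have : ~~ (4^-1 ^+ 2 <=
        sqnorm (eval_col phi x - U^T *m (U *m eval_col phi x))).
      by apply: contra_notN nofar => ?; exists x.
    rewrite -ltNge.
    (* For [a = b = 1] the matrix is the identity and [sq_split] reads as Pythagoras. *)
    have := sq_split _ U (eval_col phi x) 1 1 UU.
    rewrite subrr scale0r addr0 mul1mx.
    have := phi1 x x1; have := sqnorm_ge0 (U *m eval_col phi x).
    have := sqnorm_ge0 (eval_col phi x - U^T *m (U *m eval_col phi x)).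
    nra.
  rewrite pairing_mx_mix det_mulmx normrM ltr_pM2r ?normr_gt0//.
  rewrite det_scalar_on_rows//.
  apply/negP; rewrite -leNgt; apply: le_trans (ler_norm _).
  (* The determinant of [Q] is [3 ^ (2n) / 6 ^ j = 9 ^ n / 6 ^ j], at least 9 because [j < n]; this
     is why 2n functionals are used. *)
  have -> : 2^-1 / 3 = 6^-1 :> R by field.
  rewrite exprVn ler_pdivlMr ?exprn_gt0// addnn -mul2n exprM -(subnK jn).
  rewrite -!natrX -natrM ler_nat expnD.
  rewrite -[(3 ^ 2)%N]/9%N [(9 ^ j.+1)%N]expnS.
  have : (6 ^ j <= 9 ^ j)%N by case: (j) => // i; rewrite leq_exp2r.
  have : (0 < 9 ^ (n - j.+1))%N by rewrite expn_gt0.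
  nia.
(* Greedy choice: each new row is the normalized part of [eval_col phi z] orthogonal to the earlier
   rows, with [z] given by [far]. *)
have : forall j, (j <= n)%N -> exists (U : 'M[R]_(j, n + n)) (x : 'I_j -> E),
    [/\ U *m U^T = 1%:M, forall i, `|x i| <= 1 &
        forall i, 4^-1 <= `|(U *m eval_col phi (x i)) i 0|].
  elim=> [_|j IHj jn].
    by exists 0, (fun=> 0); split=> [|[]|[]]//; apply/matrixP => - [].
  have [U [x [UU x1 xU]]] := IHj (ltnW jn).
  have [z z1] := far j U jn UU.
  set r := eval_col phi z - _ => r16.
  have Ur : U *m r = 0 by rewrite mulmxBr !mulmxA UU mul1mx subrr.
  pose rho := Num.sqrt (sqnorm r).
  have rho4 : 4^-1 <= rho.
    by rewrite -[4^-1]ger0_norm// -sqrtr_sqr ler_sqrt// sqnorm_ge0.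
  have rho0 : 0 < rho by apply: lt_le_trans rho4.
  have rr : r^T *m r = (rho ^+ 2)%:M.
    by apply/matrixP => a b; rewrite !ord1 -sqnormE sqr_sqrtr ?sqnorm_ge0// mxE.
  pose u : 'rV[R]_(n + n) := rho^-1 *: r^T.
  have uu : u *m u^T = 1%:M.
    rewrite /u linearZ/= trmxK -scalemxAl -scalemxAr rr scalerA.
    by rewrite scale_scalar_mx -expr2 -exprMn mulVf ?expr1n// gt_eqF.
  have uU : u *m U^T = 0.
    by rewrite /u -scalemxAl -trmx_mul Ur trmx0 scaler0.
  have Uu : U *m u^T = 0 by rewrite -[RHS]trmx0 -uU trmx_mul trmxK.
  pose x' (i : 'I_(1 + j)) := if fintype.split i is inr k then x k else z.
  have x'l k : x' (lshift j k) = z.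
    by rewrite /x' -[lshift j k]/(unsplit (inl k)) unsplitK.
  have x'r k : x' (rshift 1 k) = x k.
    by rewrite /x' -[rshift 1 k]/(unsplit (inr k)) unsplitK.
  have x'U (i : 'I_(1 + j)) :
      4^-1 <= `|(col_mx u U *m eval_col phi (x' i)) i 0|.
    rewrite mul_col_mx; case: (split_ordP i) => k ->.
      rewrite col_mxEu x'l.
      (* The row [u] kills the second summand, so the new coordinate is
         [rho^-1 * rho ^+ 2 = rho]. *)
      have -> : eval_col phi z = r + U^T *m (U *m eval_col phi z).
        by rewrite subrK.
      rewrite mulmxDr !mulmxA uU !mul0mx addr0 /u -scalemxAl rr scale_scalar_mx.
      rewrite ord1 mxE eqxx mulr1n expr2 mulKf ?gt_eqF// ger0_norm//.
      exact: ltW.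
    by rewrite col_mxEd x'r.
  exists (col_mx u U : 'M[R]_(1 + j, n + n)), x'; split=> //.
    transitivity (1%:M : 'M[R]_(1 + j)) => //.
    by rewrite scalar_mx_block -UU -uu -uU -Uu -mul_col_row -tr_col_mx.
  by move=> i; rewrite /x'; case: fintype.split.
move=> /(_ n (leqnn n))[U [x [UU x1 xU]]].
exists (mix U phi), x; split=> //.
  (* Bessel's inequality for the orthonormal rows of [U]. *)
  move=> z z1; rewrite eval_col_mix; apply: le_trans (phi1 z z1).
  have := sq_split _ U (eval_col phi z) 1 1 UU.
  rewrite subrr scale0r addr0 mul1mx => ->.
  by rewrite !expr1n !mul1r lerDl sqnorm_ge0.
by move=> k; have := xU k; rewrite -eval_col_mix mxE.
Qed.

End DvoretzkyRogers.

(** * Admissible tuples in the free Banach lattice norm *)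

Section PowerSums.
Variable R : realType.
Implicit Types (a b r : R) (q : \bar R).

(** Otherwise [C] bounds every [n ^ (a - b)], which fails once [n] exceeds [C ^ (1 / (a - b))]. *)
Lemma powR_growth a b (C : R) :
  (forall n : nat, (0 < n)%N -> n%:R `^ a <= C * n%:R `^ b) -> a <= b.
Proof.
move=> nab; rewrite leNgt; apply/negP => ba.
have d0 : 0 < a - b by rewrite subr_gt0.
have C1 : 1 <= C by have := nab 1%N isT; rewrite !powR1 mulr1.
have C0 : 0 <= C by exact: le_trans C1.
pose n := (Num.truncn (C `^ (a - b)^-1)).+1.
have : (C `^ (a - b)^-1) `^ (a - b) < n%:R `^ (a - b).
  by rewrite gt0_ltr_powR// ?nnegrE ?powR_ge0// truncnS_gt.
rewrite -powRrM mulVf ?gt_eqF// powRr1// powRB ?pnatr_eq0 ?implybT//.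
rewrite ltr_pdivlMr ?powR_gt0 ?ltr0n//.
by have := nab n isT; rewrite leNgt => /negP.
Qed.

(** The convention [1 / +oo = 0] lets [n ^ (1/q)] cover [q = +oo] as well. *)
Definition inve q : R := if q is r%:E then r^-1 else 0.

Lemma powR_sumK r n a : 0 < r -> 0 <= a ->
  (\sum_(k < n) a `^ r) `^ r^-1 = n%:R `^ r^-1 * a.
Proof.
move=> r0 a0; rewrite sumr_const card_ord.
rewrite -[X in X `^ _]mulr_natl powRM ?powR_ge0//.
by rewrite -powRrM divff ?gt_eqF// powRr1.
Qed.

Lemma ler_powR_sum r n (a b : 'I_n -> R) :
  0 < r -> (forall k, 0 <= a k <= b k) ->
  (\sum_(k < n) a k `^ r) `^ r^-1 <= (\sum_(k < n) b k `^ r) `^ r^-1.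
Proof.
move=> r0 ab; apply: ge0_ler_powR; rewrite ?nnegrE ?invr_ge0 ?(ltW r0)//.
- by apply: sumr_ge0 => k _; exact: powR_ge0.
- by apply: sumr_ge0 => k _; exact: powR_ge0.
apply: ler_sum => k _; have /andP[a0 akb] := ab k.
by apply: ge0_ler_powR; rewrite ?nnegrE ?(ltW r0)// (le_trans a0).
Qed.

Lemma lq_sum_le q n (a : 'I_n -> R) : (1 <= q)%E -> (forall k, `|a k| <= 1) ->
  lq_sum q a <= n%:R `^ inve q.
Proof.
case: q => [r||]//=; rewrite ?lee_fin => r1 a1; last first.
  by rewrite powRr0; apply: bigmax_le.
have r0 : 0 < r by exact: lt_le_trans r1.
rewrite /= -[leRHS]mulr1 -(@powR_sumK r)//.
by apply: ler_powR_sum => // k; rewrite normr_ge0 a1.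
Qed.

Lemma le_lq_sum q n (a : 'I_n -> R) k : (1 <= q)%E -> `|a k| <= lq_sum q a.
Proof.
case: q => [r||]//=; rewrite ?lee_fin => r1; last by apply: (le_bigmax_cond 0).
have r0 : 0 < r by exact: lt_le_trans r1.
rewrite -[leLHS]powRr1// -(divff (lt0r_neq0 r0)) powRrM.
apply: ge0_ler_powR; rewrite ?nnegrE ?invr_ge0 ?(ltW r0) ?powR_ge0//.
  by apply: sumr_ge0 => i _; exact: powR_ge0.
by rewrite (bigD1 k)//= lerDl; apply: sumr_ge0 => i _; exact: powR_ge0.
Qed.

End PowerSums.

(** * Norms of evaluations and rescaling of weak 2-balls *)

Section FBLNorm.
Variables (R : realType) (E : normedModType R).
Implicit Types (x : E) (r : R).
Local Open Scope classical_set_scope.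

Lemma weak_lp_ballP r n (phi : 'I_n -> topdual E) : weak_lp_ball r phi <->
  forall x, `|x| <= 1 -> \sum_(k < n) `|phi k x| `^ r <= 1.
Proof.
split=> [phir x x1|phir].
  by rewrite -lee_fin; apply: le_trans phir; apply: ereal_sup_ubound; exists x.
by apply: ge_ereal_sup => _ [x x1 <-]; rewrite lee_fin phir.
Qed.

Lemma fbl_norm_ge r n (phi : 'I_n -> topdual E) f : weak_lp_ball r phi ->
  (((\sum_(k < n) `|f (phi k)| `^ r) `^ r^-1)%:E <= fbl_norm r%:E f)%E.
Proof. by move=> phir; apply: ereal_sup_ubound; exists n, phi. Qed.

(** The empty tuple is admissible and contributes a nonnegative value. *)
Lemma fbl_norm_ge0 r (f : topdual E -> R) : (0 <= fbl_norm r%:E f)%E.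
Proof.
have /fbl_norm_ge : weak_lp_ball r (fun _ : 'I_0 => 0 : topdual E).
  by apply/weak_lp_ballP => x _; rewrite big_ord0.
by move=> /(_ f); apply: le_trans; rewrite lee_fin powR_ge0.
Qed.

(** Admissibility of a tuple, tested at the point [x] alone, is the required bound. *)
Lemma fbl_norm_delta_le1 r x : 0 < r -> `|x| <= 1 ->
  (fbl_norm r%:E (delta x) <= 1)%E.
Proof.
move=> r0 x1; apply: ge_ereal_sup => _ [n [phi [/weak_lp_ballP phir ->]]].
rewrite lee_fin; apply: (@le_trans _ _ (1 `^ r^-1)); last by rewrite powR1.
apply: ge0_ler_powR => //.
- by rewrite invr_ge0 ltW.
- by rewrite nnegrE sumr_ge0// => k _; exact: powR_ge0.
- by rewrite nnegrE.
- exact: phir.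
Qed.

Lemma fbl_norm0 r : 0 < r -> fbl_norm r%:E (0 : topdual E -> R) = 0%E.
Proof.
move=> r0; apply/eqP; rewrite eq_le fbl_norm_ge0 andbT.
apply: ge_ereal_sup => _ [n [phi [_ ->]]].
rewrite big1 ?powR0 ?invr_eq0 ?gt_eqF// => k _.
by rewrite normr0 powR0// gt_eqF.
Qed.

Lemma delta_FBL r x : 0 < r -> `|x| <= 1 -> FBL E r%:E (delta x).
Proof.
move=> r0 x1; split; first split.
- by move=> a phi _; exact: topdualZE.
- by apply: le_lt_trans (fbl_norm_delta_le1 r0 x1) _; rewrite ltry.
move=> e e0; exists (delta x); first by apply: sub_gen_smallest; exists x.
by rewrite subrr fbl_norm0// lte_fin.
Qed.

(* Hoelder: passing from exponent 2 to r < 2 costs n^(1/r - 1/2). *)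
Lemma weak2_ball_weak_lp r n (phi : 'I_n -> topdual E) : (0 < n)%N -> 1 <= r ->
  weak2_ball phi ->
  weak_lp_ball r
    (fun k => (2^-1 * n%:R `^ ((Num.max 2 r)^-1 - r^-1)) *: phi k).
Proof.
move=> n0 r1 phi1; apply/weak_lp_ballP => x x1.
have r0 : 0 < r by exact: lt_le_trans r1.
have sq1 : \sum_(k < n) `|phi k x| ^+ 2 <= 1.
  apply: le_trans (phi1 x x1); apply: ler_sum => k _.
  by rewrite mxE real_normK ?num_real.
have nR0 : 0 < n%:R :> R by rewrite ltr0n.
(* For [r >= 2] the power of [n] is 1, and [t ^ r <= t ^ 2] for [t] in the unit interval. *)
have [r2|r2] := leP 2 r.
  apply: le_trans sq1; apply: ler_sum => k _.
  rewrite subrr powRr0 mulr1 topdualZE normrM ger0_norm ?invr_ge0//.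
  rewrite -powR_mulrn//.
  have t1 : `|phi k x| <= 1 by exact: weak2_ball_le1.
  have [->|t0] := eqVneq `|phi k x| 0; first by rewrite mulr0 !powR0 ?gt_eqF.
  have {}t0 : 0 < `|phi k x| by rewrite lt_def t0/=.
  apply: (@le_trans _ _ (`|phi k x| `^ r)).
    by apply: ge0_ler_powR; rewrite ?nnegrE ?(ltW r0)//; lra.
  by apply: ger_powR => //; rewrite t0.
(* For [r < 2] put [s = n ^ (1/2) * t]: each term is [2 ^ (- r) * s ^ r / n], and
   [s ^ r <= 1 + s ^ 2]. Summing gives at most [(1 + 1) / 2], which explains the factor [2^-1]. *)
apply: (@le_trans _ _
  (\sum_(k < n) (2^-1 * n%:R^-1 * (1 + n%:R * `|phi k x| ^+ 2)))).
  apply: ler_sum => k _; set t := `|phi k x|.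
  have t0 : 0 <= t by exact: normr_ge0.
  rewrite topdualZE normrM ger0_norm ?mulr_ge0 ?powR_ge0// -/t.
  rewrite !powRM ?mulr_ge0 ?powR_ge0// -powRrM mulrBl mulVf ?gt_eqF//.
  rewrite powRB; last by rewrite (gt_eqF nR0) implybT.
  rewrite powRr1// -!mulrA.
  apply: ler_pM; rewrite ?powR_ge0 ?mulr_ge0 ?invr_ge0 ?powR_ge0//.
    by rewrite -[leRHS]powRr1//; apply: ger_powR => //; lra.
  rewrite mulrCA ler_pM2l ?invr_gt0//.
  have -> : n%:R * t ^+ 2 = (n%:R `^ 2^-1 * t) ^+ 2.
    rewrite exprMn -[(_ `^ _) ^+ _]powR_mulrn ?powR_ge0//.
    by rewrite -powRrM mulVf// powRr1.
  rewrite powRrM -powRM ?powR_ge0//; set s := _ * t.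
  have s0 : 0 <= s by rewrite mulr_ge0 ?powR_ge0.
  have [s1|s1] := leP s 1.
    apply: (@le_trans _ _ (1 `^ r)); last by rewrite powR1 lerDl sqr_ge0.
    by apply: ge0_ler_powR; rewrite ?nnegrE ?(ltW r0).
  apply: (@le_trans _ _ (s `^ 2)); last by rewrite powR_mulrn// lerDr.
  by apply: ler_powR; rewrite ltW.
rewrite -mulr_sumr big_split/= -mulr_sumr sumr_const card_ord.
rewrite -mulrA ler_pdivrMl// mulr1 ler_pdivrMl//.
by nra.
Qed.

End FBLNorm.

(** * The bound on the convexity exponent *)

Unset Implicit Arguments.

Theorem proposition9p30 (R : realType) (E : completeNormedModType R)
    (p q : \bar R) :
  infinite_dimensional E ->
  (1 <= p)%E -> (1 <= q)%E ->
  q_convex (FBL E p) (fbl_norm p) q ->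
  (q <= Order.max 2%:E p)%E.
Proof.
move=> Einf; case: p => [r||]// r1 q1 [M FBLq]; last first.
  by rewrite le_max leey orbT.
rewrite lee_fin in r1; have r0 : 0 < r by exact: lt_le_trans r1.
pose m := Num.max 2 r.
have m0 : 0 < m by rewrite lt_max r0 orbT.
have mq : m^-1 <= inve q.
  apply: (@powR_growth _ _ _ (8 * `|M|)) => n n0.
  have [phi [x [phi1 x1 phix]]] := dvoretzky_rogers n Einf.
  have FBLx k := delta_FBL r0 (x1 k).
  set c := 2^-1 * n%:R `^ (m^-1 - r^-1).
  have c0 : 0 <= c by rewrite mulr_ge0 ?powR_ge0.
  have cphi : weak_lp_ball r (fun k => c *: phi k) by exact: weak2_ball_weak_lp.
  have := le_trans (fbl_norm_ge _ cphi) (FBLq n (fun k => delta (x k)) FBLx).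
  rewrite lee_fin => lower_upper.
  have dnorm k : `|fine (fbl_norm r%:E (delta (x k)))| <= 1.
    have d0 := fbl_norm_ge0 r (delta (x k)).
    have d1 := fbl_norm_delta_le1 r0 (x1 k).
    rewrite ger0_norm ?fine_ge0// -lee_fin fineK// ge0_fin_numE//.
    by rewrite (le_lt_trans d1)// ltry.
  have upper : M * lq_sum q (fun k => fine (fbl_norm r%:E (delta (x k))))
      <= `|M| * n%:R `^ inve q.
    apply: le_trans (ler_wpM2l (normr_ge0 M) (lq_sum_le q1 dnorm)).
    apply: ler_wpM2r (ler_norm M).
    (* [M] may be negative, so passing to its absolute value uses that the sum is nonnegative, read
       off from one entry. *)
    exact: le_trans (le_lq_sum _ (Ordinal n0) q1).
  (* Only the entry [k = j] of the inner sum is kept; it is at least [c / 4], and n such terms give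
     [n ^ (1/r) * c / 4 = n ^ (1/m) / 8]. *)
  have lower : 8^-1 * n%:R `^ m^-1 <=
      (\sum_(j < n) `|lq_sum q (fun k => delta (x k) (c *: phi j))| `^ r)
        `^ r^-1.
    have -> : 8^-1 * n%:R `^ m^-1 = n%:R `^ r^-1 * (4^-1 * c).
      rewrite /c powRB; last by rewrite pnatr_eq0 -lt0n n0 implybT.
      by field; rewrite gt_eqF// powR_gt0// ltr0n.
    rewrite -powR_sumK ?mulr_ge0//; apply: ler_powR_sum => // j.
    rewrite mulr_ge0//=; apply: le_trans (ler_norm _).
    apply: le_trans (le_lq_sum _ j q1).
    rewrite -[leRHS]/`|c * phi j (x j)| normrM (ger0_norm c0).
    by rewrite mulrC ler_wpM2l.
  by have := le_trans lower (le_trans lower_upper upper); lra.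
case: q q1 {FBLq} mq => [s||]//=.
  rewrite lee_fin => s1; rewrite lef_pV2 ?posrE// ?(lt_le_trans _ s1)//.
  by rewrite -EFin_max lee_fin.
(* For [q = +oo] the bound reads [m^-1 <= 0], contradicting [0 < m]. *)
by rewrite invr_le0 => _ /(lt_le_trans m0); rewrite ltxx.
Qed.
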